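(* Let $\Sigma$ be a signature, $l$ a logic over $\Sigma$ (with set of variables $X$), $\mathbf{K}$ a class of $\Sigma$-structures and $\mathbf{K}^Q$ the quasivariety generated by $\mathbf{K}$. Then $l$ has an algebraic semantics in $\mathbf{K}$ if and only if $l$ has a presentation by an equational filter pair of the form $(Co_{\mathbf{K}^Q}, i)$.
   Context: A signature $\Sigma=(\Sigma_n)_{n\in\mathbb{N}}$ is a sequence of pairwise disjoint sets of $n$-ary function symbols; $\Sigma$-structures (algebras) and homomorphisms are as usual. $Fm(X)$ is the absolutely free $\Sigma$-structure of formulas with variables in $X$. A logic over $\Sigma$ is a pair $l=(\Sigma,\vdash_l)$ with $\vdash_l\subseteq \mathcal{P}(Fm(X))\times Fm(X)$ a reflexive, monotone, cut-closed, finitary relation which is structural (if $\Gamma\vdash_l\varphi$ and $\sigma$ is an endomorphism of $Fm(X)$, then $\sigma[\Gamma]\vdash_l\sigma(\varphi)$). An equation is a pair of formulas, written $\delta\approx\epsilon$. For a class $\mathbf{K}$ of $\Sigma$-structures, $\Gamma\models_{\mathbf{K}}\varphi\approx\psi$ means: for every $A\in\mathbf{K}$ and homomorphism $h:Fm(X)\to A$, if $h(\eta)=h(\nu)$ for all $\eta\approx\nu$ in $\Gamma$, then $h(\varphi)=h(\psi)$. The logic $l$ has an algebraic semantics in $\mathbf{K}$ if there is a finite set $\tau$ of equations $\delta(x)\approx\epsilon(x)$ in at most one variable $x$ such that for all $\Gamma\cup\{\varphi\}\subseteq Fm(X)$: $\Gamma\vdash_l\varphi$ if and only if $\{\delta(\gamma)\approx\epsilon(\gamma)\mid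 \gamma\in\Gamma,\ \delta\approx\epsilon\in\tau\}\models_{\mathbf{K}}\delta(\varphi)\approx\epsilon(\varphi)$ for all $\delta\approx\epsilon\in\tau$. A quasivariety is a class of $\Sigma$-structures axiomatizable by quasi-identities. For a quasivariety $\mathbf{Q}$ and a $\Sigma$-structure $A$, $Co_{\mathbf{Q}}(A)$ is the algebraic lattice (under inclusion) of congruences $\theta$ on $A$ with $A/\theta\in\mathbf{Q}$; for a homomorphism $f:A\to B$, $Co_{\mathbf{Q}}(f)=(f\times f)^{-1}$. An equational filter pair is a pair $(Co_{\mathbf{Q}},i^\tau)$ with $\mathbf{Q}$ a quasivariety, $\tau$ a finite set of equations in at most one variable, and $i^\tau_A:Co_{\mathbf{Q}}(A)\to\mathcal{P}(A)$, $i^\tau_A(\theta)=\{a\in A\mid \langle\delta^A(a),\epsilon^A(a)\rangle\in\theta \text{ for all }\delta\approx\epsilon\in\tau\}$, for every $\Sigma$-structure $A$. The logic presented by (associated to) it, with variables $X$, is given by: $\Gamma\vdash\varphi$ iff for all $\theta\in Co_{\mathbf{Q}}(Fm(X))$, $\Gamma\subseteq i^\tau_{Fm(X)}(\theta)$ implies $\varphi\in i^\tau_{Fm(X)}(\theta)$. A logic has a presentation by a filter pair if it equals the logic associated to that filter pair.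
   Formalization: ''Algebraic semantics in K'' is required only for finite Γ, since for arbitrary Γ a logic presented by (Co_{K^Q}, i) need not have an algebraic semantics in K when the consequence relation of K is not finitary. *)

(* Defs.v *)
From mathcomp Require Import all_boot.
From mathcomp Require Import generic_quotient boolp classical_sets cardinality.

Set Implicit Arguments.
Unset Strict Implicit.
Unset Printing Implicit Defensive.

Local Open Scope quotient_scope.
Local Open Scope classical_set_scope.

(* [S n] is the type of n-ary function symbols; distinct arities are disjoint
   by typing. *)
Definition signature := nat -> Type.

(* The carrier may be empty: nothing forces Fm(X) to be inhabited. *)
Record algebra (S : signature) := Algebra {
  carrier :> Type;
  op : forall n, S n -> ('I_n -> carrier) -> carrier }.

(* [set (algebra S)] would be a universe inconsistency. *)
Definition class (S : signature) := algebra S -> Prop.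

Record hom (S : signature) (A B : algebra S) := Hom {
  hom_fun :> A -> B;
  hom_op : forall n (f : S n) (a : 'I_n -> A),
    hom_fun (op f a) = op f (fun i => hom_fun (a i)) }.

Inductive term (S : signature) (X : Type) : Type :=
| Var of X
| App n of S n & ('I_n -> term S X).

Definition Fm (S : signature) (X : Type) : algebra S :=
  @Algebra S (term S X) (@App S X).

Fixpoint eval (S : signature) (X : Type) (A : algebra S) (v : X -> A)
    (t : term S X) : A :=
  match t with
  | Var x => v x
  | App _ f ts => op f (fun i => eval v (ts i))
  end.

Definition equation (S : signature) (X : Type) : Type :=
  (term S X * term S X)%type.

Record logic (S : signature) (X : Type) := Logic {
  entails : set (Fm S X) -> Fm S X -> Prop;
  entails_refl : forall (G : set (Fm S X)) p, G p -> entails G p;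
  entails_mono : forall (G D : set (Fm S X)) p,
    G `<=` D -> entails G p -> entails D p;
  entails_cut : forall (G D : set (Fm S X)) p,
    (forall q, D q -> entails G q) -> entails (G `|` D) p -> entails G p;
  entails_finitary : forall (G : set (Fm S X)) p, entails G p ->
    exists D, [/\ finite_set D, D `<=` G & entails D p];
  entails_struct : forall (G : set (Fm S X)) p (s : hom (Fm S X) (Fm S X)),
    entails G p -> entails (s @` G) (s p) }.

Definition eq_entails (S : signature) (X : Type) (K : class S)
    (E : set (equation S X)) (e : equation S X) : Prop :=
  forall A : algebra S, K A -> forall h : hom (Fm S X) A,
    (forall d, E d -> h d.1 = h d.2) -> h e.1 = h e.2.

(* Equations in at most one variable are equations over the one-element
   variable set [unit]; [d^A(a)] is [eval1 a d]. *)
Definition eval1 (S : signature) (A : algebra S) (a : A) (d : term S unit) : A :=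
  eval (fun=> a) d.

Definition tau_eqs (S : signature) (X : Type) (tau : set (equation S unit))
    (G : set (Fm S X)) : set (equation S X) :=
  [set e | exists d g,
     [/\ tau d, G g & e = (eval1 g d.1, eval1 g d.2)]].

Record quasi_identity (S : signature) := QuasiIdentity {
  premises : set (equation S nat);
  premises_finite : finite_set premises;
  conclusion : equation S nat }.

Definition satisfies (S : signature) (A : algebra S) (q : quasi_identity S) :
    Prop :=
  forall v : nat -> A,
    (forall d, premises q d -> eval v d.1 = eval v d.2) ->
    eval v (conclusion q).1 = eval v (conclusion q).2.

Definition quasivariety (S : signature) (Q : class S) : Prop :=
  exists ax : quasi_identity S -> Prop,
    forall A, Q A <-> (forall q, ax q -> satisfies A q).

Definition generated_quasivariety (S : signature) (K : class S) : class S :=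
  fun A => forall Q : class S,
    quasivariety Q -> (forall B, K B -> Q B) -> Q A.

Record congruence (S : signature) (A : algebra S) := Congruence {
  cong_rel :> A -> A -> Prop;
  cong_refl : forall a, cong_rel a a;
  cong_sym : forall a b, cong_rel a b -> cong_rel b a;
  cong_trans : forall a b c, cong_rel a b -> cong_rel b c -> cong_rel a c;
  cong_op : forall n (f : S n) (a b : 'I_n -> A),
    (forall i, cong_rel (a i) (b i)) -> cong_rel (op f a) (op f b) }.

Section Quotient.
Variables (S : signature) (A : algebra S) (th : congruence A).

Let r (a b : {classic A}) : bool := `[< th a b >].

Let r_refl : reflexive r.
Proof. by move=> a; apply/asboolP; exact: cong_refl. Qed.

Let r_sym : symmetric r.
Proof. by move=> a b; apply/asboolP/asboolP; exact: cong_sym. Qed.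

Let r_trans : transitive r.
Proof.
by move=> b a c /asboolP ab /asboolP bc; apply/asboolP; exact: cong_trans ab bc.
Qed.

Definition cong_equiv : equiv_rel {classic A} := EquivRel r r_refl r_sym r_trans.

Definition quotient : algebra S :=
  @Algebra S {eq_quot cong_equiv}
    (fun n f a => \pi_{eq_quot cong_equiv} (op f (fun i => repr (a i)))).

End Quotient.

Definition Co (S : signature) (Q : class S) (A : algebra S)
    (th : congruence A) : Prop := Q (quotient th).

(* The pair (Co_Q, i^tau) is determined by Q and tau. *)
Record equational_filter_pair (S : signature) := EquationalFilterPair {
  fp_class : class S;
  fp_quasivariety : quasivariety fp_class;
  fp_eqs : set (equation S unit);
  fp_eqs_finite : finite_set fp_eqs }.

Definition fp_map (S : signature) (F : equational_filter_pair S)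
    (A : algebra S) (th : congruence A) : set A :=
  [set a | forall d, fp_eqs F d -> th (eval1 a d.1) (eval1 a d.2)].

Definition fp_entails (S : signature) (X : Type) (F : equational_filter_pair S)
    (G : set (Fm S X)) (p : Fm S X) : Prop :=
  forall th : congruence (Fm S X), Co (fp_class F) th ->
    G `<=` fp_map F th -> fp_map F th p.

Definition presents (S : signature) (X : Type) (F : equational_filter_pair S)
    (l : logic S X) : Prop :=
  forall (G : set (Fm S X)) (p : Fm S X), entails l G p <-> fp_entails F G p.

(* [G] ranges over finite sets only.  [l] is finitary and hence determined by
   these instances, whereas [eq_entails K] need not be finitary for an arbitrary
   class K.  With arbitrary [G], a semantics in [generated_quasivariety K] need
   not restrict to one in K: take the unary algebra on nat with zero 0, where
   f_n and g fix 0 and, for k > 0, f_n k = 0 if n < k.-1 else 1, and g k = 1.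
   On it {f_n x = 0 | n} entails g x = 0 but no finite subset does. *)
Definition algebraic_semantics (S : signature) (X : Type) (l : logic S X)
    (K : class S) : Prop :=
  exists2 tau : set (equation S unit), finite_set tau &
    forall (G : set (Fm S X)) (p : Fm S X), finite_set G ->
      (entails l G p <->
       forall d, tau d ->
         eq_entails K (tau_eqs tau G) (eval1 p d.1, eval1 p d.2)).

(* Main.v *)
From mathcomp Require Import all_boot.
From mathcomp Require Import generic_quotient boolp classical_sets functions cardinality.
Require Import Defs.

(** Both conditions compare, for each [tau], the consequence relation of [K] on
    the equations [tau_eqs tau G] with congruences whose quotient lies in
    [K^Q].  For finite [G] the two agree: such a consequence is a single
    quasi-identity, so it passes from [K] to [K^Q], and conversely the kernel of
    a homomorphism into a member of [K] is a [K^Q]-congruence.  For arbitrary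
    [G] the filter pair is finitary: the equations that follow over [K] from
    [tau_eqs tau D] for some finite [D `<=` G] form a [K^Q]-congruence, because
    quasi-identities have finitely many premises.  As [l] is finitary, finite
    [G] suffice. *)

Set Implicit Arguments.
Unset Strict Implicit.
Unset Printing Implicit Defensive.

Local Open Scope quotient_scope.
Local Open Scope classical_set_scope.

(** * Terms: homomorphisms out of [Fm S X] as evaluations, finiteness of variables *)

Section Terms.
Variable S : signature.

Lemma hom_eval (X : Type) (A B : algebra S) (h : hom A B) (v : X -> A)
    (t : term S X) : h (eval v t) = eval (fun x => h (v x)) t.
Proof.
elim: t => [x//|n f ts IH] /=; rewrite hom_op; congr op.
by apply/funext => i; exact: IH.
Qed.

Definition eval_hom (X : Type) (A : algebra S) (v : X -> A) : hom (Fm S X) A :=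
  @Hom S (Fm S X) A (eval v) (fun _ _ _ => erefl).

Lemma eval_Var (X : Type) (t : term S X) : eval (A := Fm S X) (@Var S X) t = t.
Proof.
by elim: t => [x//|n f ts IH] /=; congr App; apply/funext => i; exact: IH.
Qed.

Lemma homE (X : Type) (A : algebra S) (h : hom (Fm S X) A) (t : Fm S X) :
  h t = eval (fun x => h (Var S x)) t.
Proof. by rewrite -[in LHS](eval_Var t) hom_eval. Qed.

Fixpoint vars (X : Type) (t : term S X) : set X :=
  match t with
  | Var x => [set x]
  | App _ _ ts => \bigcup_i vars (ts i)
  end.

Lemma finite_vars (X : Type) (t : term S X) : finite_set (vars t).
Proof.
by elim: t => [x|n f ts IH] /=; [exact: finite_set1 | exact: bigcup_finite].
Qed.

Lemma eq_eval (X : Type) (A : algebra S) (v w : X -> A) (t : term S X) :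
  (forall x, vars t x -> v x = w x) -> eval v t = eval w t.
Proof.
elim: t => [x|n f ts IH] /= vw; first exact: vw.
congr op; apply/funext => i; apply: IH => x tx; apply: vw; by exists i.
Qed.

End Terms.

(** * Kernels, quotients and quasi-identities in a quotient *)

Section Congruences.
Variable S : signature.

Definition kernel (A B : algebra S) (h : hom A B) : congruence A.
Proof.
refine (@Congruence S A (fun a b => h a = h b) _ _ _ _) => //.
- by move=> a b c -> ->.
- by move=> n f a b ab; rewrite !hom_op; congr op; apply/funext.
Defined.

Variables (A : algebra S) (th : congruence A).

Definition quotient_map (a : A) : quotient th :=
  \pi_({eq_quot cong_equiv th}) (a : {classic A}).

Definition quotient_repr (b : quotient th) : A :=
  repr (b : {eq_quot cong_equiv th}).

Lemma quotient_reprK : cancel quotient_repr quotient_map.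
Proof. by move=> b; exact: reprK. Qed.

Lemma quotient_mapP (a b : A) : quotient_map a = quotient_map b <-> th a b.
Proof.
split=> [/eqmodP/asboolP//|ab]; by apply/eqmodP/asboolP.
Qed.

Lemma quotient_map_op n (f : S n) (a : 'I_n -> A) :
  quotient_map (op f a) = op f (fun i => quotient_map (a i)).
Proof.
apply/quotient_mapP/cong_op => i.
by apply/quotient_mapP; rewrite quotient_reprK.
Qed.

Definition quotient_hom : hom A (quotient th) := Hom quotient_map_op.

Lemma satisfies_quotient (q : quasi_identity S) :
  satisfies (quotient th) q <->
  forall v : nat -> A,
    (forall d, premises q d -> th (eval v d.1) (eval v d.2)) ->
    th (eval v (conclusion q).1) (eval v (conclusion q).2).
Proof.
have E (v : nat -> A) (t : term S nat) :
  eval (fun x => quotient_map (v x)) t = quotient_map (eval v t).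
  by rewrite -[RHS]/(quotient_hom _) hom_eval.
split=> [sat v prem|sat v].
  by apply/quotient_mapP; rewrite -!E; apply: sat => d /prem; rewrite !E quotient_mapP.
(* Every valuation in the quotient lifts to [A] through representatives. *)
have -> : v = fun x => quotient_map (quotient_repr (v x)).
  by apply/funext => x; rewrite quotient_reprK.
move=> prem; rewrite !E; apply/quotient_mapP/sat => d /prem.
by rewrite !E quotient_mapP.
Qed.

End Congruences.

(** * The quasivariety generated by [K] and its consequence relation *)

Section GeneratedQuasivariety.
Variables (S : signature) (K : class S).

(** The models of a single quasi-identity form a quasivariety, which gives the left-to-right
    direction; conversely, the axioms of any quasivariety containing [K] are valid in [K]. *)
Lemma generated_quasivarietyP (A : algebra S) :
  generated_quasivariety K A <->
  forall q, (forall B, K B -> satisfies B q) -> satisfies A q.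
Proof.
split=> [KA q Kq|KA Q [ax QE] KQ].
  apply: (KA (fun B => satisfies B q)) => //.
  by exists (eq q) => B; split=> [sB _ <-//|]; apply.
by apply/QE => q axq; apply: KA => B /KQ/QE; exact.
Qed.

Lemma quasivariety_generated : quasivariety (generated_quasivariety K).
Proof.
exists (fun q => forall B, K B -> satisfies B q) => A.
exact: generated_quasivarietyP.
Qed.

(** The quotient by [kernel h] embeds into [B], and quasi-identities pass to subalgebras: composing
    with [h] turns valuations in [A] into valuations in [B]. *)
Lemma Co_kernel (A B : algebra S) (h : hom A B) :
  K B -> Co (generated_quasivariety K) (kernel h).
Proof.
move=> KB; apply/generated_quasivarietyP => q Kq; apply/satisfies_quotient => v.
move=> prem /=; rewrite !hom_eval; apply: Kq => // d /prem /=.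
by rewrite !hom_eval.
Qed.

(* Quasi-identities have variables in [nat], so the finitely many variables of
   the implication are renamed injectively. *)
Lemma eq_entails_generated (X : Type) (E : set (equation S X))
    (e : equation S X) :
  finite_set E -> eq_entails K E e ->
  eq_entails (generated_quasivariety K) E e.
Proof.
move=> finE KE A /generated_quasivarietyP KA h hE.
pose V := vars e.1 `|` vars e.2 `|` \bigcup_(d in E) (vars d.1 `|` vars d.2).
have finV : finite_set V.
  rewrite !finite_setU; split; first by split; exact: finite_vars.
  by apply: bigcup_finite => // d _; rewrite finite_setU; split; exact: finite_vars.
have [r rinj] : exists r : X -> nat, set_inj V r.
  have /pcard_leP[f] := finite_set_countable finV.
  by exists f; exact: inj.
pose ren t := eval (A := Fm S nat) (fun x => Var S (r x)) t.
have renE (B : algebra S) (v : nat -> B) t :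
    eval v (ren t) = eval (fun x => v (r x)) t.
  exact: (hom_eval (eval_hom v)).
pose rene (d : equation S X) := (ren d.1, ren d.2).
pose q := QuasiIdentity (finite_image rene finE) (rene e).
have Kq B : K B -> satisfies B q.
  move=> KB v prem /=; rewrite !renE.
  apply: (KE _ KB (eval_hom (fun x => v (r x)))) => d Ed /=.
  by rewrite -!renE; apply: (prem (rene d)); exists d.
(* [v] undoes the renaming on [V], where injectivity of [r] leaves a single candidate. Outside the
   image of [V] it takes the default [h e.1], an element at hand even though carriers may be
   empty. *)
pose v n : A := xget (h e.1 : {classic A})
  [set (h (Var S x) : {classic A}) | x in [set x | V x /\ r x = n]].
have vr x : V x -> v (r x) = h (Var S x).
  move=> Vx; rewrite /v; case: xgetP => [_ -> [y [Vy ryx] <-]|/(_ (h (Var S x)))[]].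
    by congr (h (Var S _)); apply: rinj; rewrite ?inE.
  by exists x.
have vE t : vars t `<=` V -> eval v (ren t) = h t.
  by move=> tV; rewrite renE [RHS]homE; apply: eq_eval => x /tV; exact: vr.
rewrite -(vE e.1) => [|x ex]; last by left; left.
rewrite -(vE e.2) => [|x ex]; last by left; right.
apply: (KA q Kq v) => _ [d Ed <-] /=.
by rewrite !vE; [exact: hE| |] => x dx; right; exists d => //; [right|left].
Qed.

End GeneratedQuasivariety.

(** * Filter pairs over the generated quasivariety: finite premises, then finitarity *)

Section EquationalFilterPairs.
Variables (S : signature) (X : Type).
Implicit Types (G D : set (Fm S X)) (p : Fm S X).

Lemma finite_tau_eqs (tau : set (equation S unit)) G :
  finite_set tau -> finite_set G -> finite_set (tau_eqs tau G).
Proof.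
move=> ft fG; apply: sub_finite_set (finite_image2
  (fun d g => (eval1 g d.1, eval1 g d.2)) ft fG).
by move=> _ [d [g [td Gg ->]]]; exists d => //; exists g.
Qed.

Lemma tau_eqs_sub (tau : set (equation S unit)) G D :
  D `<=` G -> tau_eqs tau D `<=` tau_eqs tau G.
Proof. by move=> DG _ [d [g [td /DG Gg ->]]]; exists d, g. Qed.

Lemma eq_entails_sub (K : class S) (E E' : set (equation S X)) e :
  E `<=` E' -> eq_entails K E e -> eq_entails K E' e.
Proof. by move=> EE' KE A KA h hE'; apply: KE => // d /EE'; exact: hE'. Qed.

Variables (K : class S) (F : equational_filter_pair S).
Hypothesis FK : fp_class F = generated_quasivariety K.
Local Notation tau := (fp_eqs F).

Lemma fp_entails_finiteP G p : finite_set G ->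
  fp_entails F G p <->
  forall d, tau d -> eq_entails K (tau_eqs tau G) (eval1 p d.1, eval1 p d.2).
Proof.
move=> finG; split=> [Fp d td B KB h hG /=|Kp th].
  apply: (Fp (kernel h)) => // [|g Gg d' td' /=]; first by rewrite FK; exact: Co_kernel.
  by apply: (hG (eval1 g d'.1, eval1 g d'.2)); exists d', g.
(* The quotient map is a homomorphism into a member of K^Q, so the consequence, once transferred
   from [K], applies to it. *)
rewrite FK => Qth Gth d td; apply/quotient_mapP.
apply: (eq_entails_generated _ (Kp d td) Qth (h := quotient_hom th)).
  exact: finite_tau_eqs (fp_eqs_finite F) finG.
by move=> _ [d' [g [td' /Gth gth ->]]]; apply/quotient_mapP; exact: gth.
Qed.

(** This is the least K^Q-congruence containing [tau_eqs tau G]; consequence over [K] from all of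
    [tau_eqs tau G] can be strictly larger. *)
Definition finitely_entailed G (a b : Fm S X) : Prop :=
  exists D, [/\ finite_set D, D `<=` G & eq_entails K (tau_eqs tau D) (a, b)].

(** The union of finitely many finite witnesses is again finite and entails each equation by
    monotonicity. *)
Lemma finitely_entailed_uniform (T : Type) (I : set T) G (a b : T -> Fm S X) :
  finite_set I -> (forall i, I i -> finitely_entailed G (a i) (b i)) ->
  exists D, [/\ finite_set D, D `<=` G &
    forall i, I i -> eq_entails K (tau_eqs tau D) (a i, b i)].
Proof.
move=> finI H.
(* Choice needs a witness for every [i]; outside [I] the empty set serves. *)
have {}H i : exists D, [/\ finite_set D, D `<=` G &
    I i -> eq_entails K (tau_eqs tau D) (a i, b i)].
  have [/H[D [fD DG KD]]|nI] := pselect (I i); first by exists D.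
  by exists set0; split=> // x [].
have [D HD] := choice H.
exists (\bigcup_(i in I) D i); split.
- by apply: bigcup_finite => // i _; case: (HD i).
- by apply: bigcup_sub => i _; case: (HD i).
- move=> i Ii; have [_ _ /(_ Ii)] := HD i; apply: eq_entails_sub.
  by apply: tau_eqs_sub; exact: bigcup_sup.
Qed.

Definition finitely_entailed_cong G : congruence (Fm S X).
Proof.
refine (@Congruence S (Fm S X) (finitely_entailed G) _ _ _ _).
- by move=> a; exists set0; split=> // A KA h _.
- move=> a b [D [fD DG KD]]; exists D; split=> // A KA h hD.
  by apply/esym/(KD A KA h hD).
- move=> a b c ab bc.
  (* The two equations [(a, b)] and [(b, c)] are indexed by [bool] to get a common [D]. *)
  have [||D [fD DG KD]] := @finitely_entailed_uniform bool setT G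
      (fun i => if i then a else b) (fun i => if i then b else c).
  + exact: finite_finset.
  + by case.
  + exists D; split=> // A KA h hD.
    by have /= -> := KD true I A KA h hD; have := KD false I A KA h hD.
- move=> n f a b ab.
  have [||D [fD DG KD]] := @finitely_entailed_uniform 'I_n setT G a b => //.
  exists D; split=> // A KA h hD; rewrite !(hom_op h); congr op; apply/funext => i.
  exact: (KD i I A KA h hD).
Defined.

Lemma Co_finitely_entailed G : Co (generated_quasivariety K) (finitely_entailed_cong G).
Proof.
apply/generated_quasivarietyP => q Kq; apply/satisfies_quotient => v prem.
have [D [fD DG KD]] := finitely_entailed_uniform (premises_finite q) prem.
exists D; split=> // A KA h hD; rewrite !hom_eval; apply: Kq => // d qd.
by have := KD d qd A KA h hD; rewrite /= !hom_eval.
Qed.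

Lemma fp_entails_finitary G p : fp_entails F G p ->
  exists D, [/\ finite_set D, D `<=` G & fp_entails F D p].
Proof.
move=> /(_ (finitely_entailed_cong G)); rewrite FK => Fp.
have {}Fp := Fp (Co_finitely_entailed G).
have [|D [fD DG KD]] := finitely_entailed_uniform (fp_eqs_finite F) (Fp _).
  (* [G] lies in the filter of this congruence because each [g] is supported by the singleton of
     [g]. *)
  move=> g Gg d td; exists [set g]; split=> [||A KA h]; first exact: finite_set1.
    by move=> _ ->.
  by apply; exists d, g.
by exists D; split=> //; apply/fp_entails_finiteP.
Qed.

End EquationalFilterPairs.

Theorem theorem4p4 (S : signature) (X : Type) (l : logic S X) (K : class S) :
  algebraic_semantics l K <->
  exists F : equational_filter_pair S,
    fp_class F = generated_quasivariety K /\ presents F l.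
Proof.
split=> [[tau ftau semK]|[F [FK Fl]]]; last first.
  exists (fp_eqs F); first exact: fp_eqs_finite.
  by move=> G p finG; rewrite Fl; exact: fp_entails_finiteP.
pose F := EquationalFilterPair (quasivariety_generated K) ftau.
have lF D p : finite_set D -> entails l D p <-> fp_entails F D p.
  by move=> finD; rewrite semK // (fp_entails_finiteP (K := K)).
have FK : fp_class F = generated_quasivariety K by [].
exists F; split=> // G p; split=> [/entails_finitary|/(fp_entails_finitary FK)].
  case=> D [finD DG /(lF _ _ finD) Dp] th Qth Gth.
  by apply: Dp => // g /DG; exact: Gth.
by case=> D [finD DG /(lF _ _ finD)]; exact: entails_mono.
Qed.
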